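(* Let $\mathbb{F}\in\{\mathbb{R},\mathbb{C}\}$ and let $A\in\mathbb{F}_d[z,z^{-1}]$ satisfy $A^{\rm T}=-A$ and be invertible on the unit circle, with (symmetric) partial indices $\mathcal{K}=\{\kappa_1\ge\dots\ge\kappa_d\}$. Then there exists a factorization $A=A_+D_3A_+^{\rm T}$ with $A_+\in\mathbb{F}_d[z]$ invertible for all $|z|\le1$ and $$D_3=-\sum_{m\in\mathcal{M}_+}\big(z^{\kappa_m}|\bar m\rangle\langle m|-z^{-\kappa_m}|m\rangle\langle \bar m|\big)+\sum_{m\in\mathcal{M}_0,\ m\le d/2}\big(|\bar m\rangle\langle m|-|m\rangle\langle\bar m|\big).$$
   Context: $\mathbb{F}_d[z,z^{-1}]$ denotes matrix Laurent polynomials $\sum_{r=p}^qa_rz^r$ with $a_r\in\mathbb{F}_d$; $\mathbb{F}_d[z]$ those with only nonnegative powers. For $A(z)=\sum a_rz^r$, $A^{\rm T}(z):=\sum_r a_r^{\rm T}z^{-r}$. A standard WH factorization of $A$ invertible on $|z|=1$ is $A=A_+DA_-$ with $A_+$ a polynomial in $z$ invertible for $|z|\le1$, $A_-$ a polynomial in $z^{-1}$ invertible for $|z^{-1}|\le1$, $D=\mathrm{diag}(z^{\kappa_1},\dots,z^{\kappa_d})$, $\kappa_1\ge\dots\ge\kappa_d$; the $\kappa_m$ (partial indices) are unique and here form $\mathcal{K}$. $\mathcal{M}_\pm=\{m:\pm\kappa_m>0\}$, $\mathcal{M}_0=\{m:\kappa_m=0\}$, $\bar m:=d+1-m$, and $|m\rangle\langle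 m'|$ denotes the matrix unit at $(m,m')$. *)

(* Defs.v *)
From HB Require Import structures.
From mathcomp Require Import all_boot all_order all_algebra.
From mathcomp Require Import complex reals.
Set Implicit Arguments. Unset Strict Implicit. Unset Printing Implicit Defensive.
Import Order.TTheory GRing.Theory Num.Theory.
Local Open Scope ring_scope.

(* A d x d matrix Laurent polynomial  A(z) = \sum_r a_r z^r  with complex
   coefficients a_r, given by its coefficient function, which vanishes
   outside [-lbound, lbound]. *)
Record lmx (R : realType) (d : nat) := LMx {
  lcoef : int -> 'M[R[i]]_d;
  lbound : nat;
  lcoefP : forall r : int, (lbound < `|r|)%N -> lcoef r = 0 }.

Definition lev (R : realType) (d : nat) (A : lmx R d) (z : R[i]) : 'M[R[i]]_d :=
  \sum_(k < (lbound A).*2.+1)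
     (z ^ (k%:Z - (lbound A)%:Z)) *: lcoef A (k%:Z - (lbound A)%:Z).

(* evaluation of A^T(z) = \sum_r z^{-r} a_r^T *)
Definition levT (R : realType) (d : nat) (A : lmx R d) (z : R[i]) : 'M[R[i]]_d :=
  \sum_(k < (lbound A).*2.+1)
     (z ^ (- (k%:Z - (lbound A)%:Z))) *: (lcoef A (k%:Z - (lbound A)%:Z))^T.

Definition is_poly_z (R : realType) (d : nat) (A : lmx R d) : Prop :=
  forall r : int, r < 0 -> lcoef A r = 0.

Definition is_poly_zinv (R : realType) (d : nat) (A : lmx R d) : Prop :=
  forall r : int, 0 < r -> lcoef A r = 0.

Definition lmx_real (R : realType) (d : nat) (A : lmx R d) : Prop :=
  forall (r : int) (i j : 'I_d), lcoef A r i j \is Num.real.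

Definition Dkappa (R : realType) (d : nat) (kappa : 'I_d -> int) (z : R[i])
  : 'M[R[i]]_d := diag_mx (\row_m (z ^ kappa m)).

(* kappa is the (nonincreasing) tuple of partial indices of A: A admits a
   standard Wiener-Hopf factorization A = A_+ D A_- with
   A_+ polynomial in z, invertible for |z| <= 1 (z = 0 included),
   A_- polynomial in w = z^{-1}, invertible for |w| <= 1 (w = 0 included;
   evaluated at w as A_-(w^{-1}) = \sum_r w^{-r} a_r, see lev_inv). *)
Definition lev_inv (R : realType) (d : nat) (A : lmx R d) (w : R[i]) : 'M[R[i]]_d :=
  \sum_(k < (lbound A).*2.+1)
     (w ^ (- (k%:Z - (lbound A)%:Z))) *: lcoef A (k%:Z - (lbound A)%:Z).

Definition WH_partial_indices (R : realType) (d : nat) (A : lmx R d)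
  (kappa : 'I_d -> int) : Prop :=
  (forall m m' : 'I_d, (m <= m')%N -> kappa m' <= kappa m) /\
  exists Ap Am : lmx R d,
    [/\ is_poly_z Ap,
        (forall z : R[i], `|z| <= 1 -> lev Ap z \in unitmx),
        is_poly_zinv Am,
        (forall w : R[i], `|w| <= 1 -> lev_inv Am w \in unitmx) &
        (forall z : R[i], z != 0 -> lev A z = lev Ap z *m Dkappa kappa z *m lev Am z)].

(* The matrix D_3 of the theorem.  Indices are 0-based: the paper's m is
   (m : 'I_d).+1, \bar m = d+1-m is rev_ord m, |a><b| is delta_mx a b,
   and "m <= d/2" reads (m.+1 <= d./2)%N. *)
Definition D3 (R : realType) (d : nat) (kappa : 'I_d -> int) (z : R[i])
  : 'M[R[i]]_d :=
  - (\sum_(m : 'I_d | 0 < kappa m)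
        ((z ^ kappa m) *: delta_mx (rev_ord m) m
         - (z ^ (- kappa m)) *: delta_mx m (rev_ord m)))
  + \sum_(m : 'I_d | (kappa m == 0) && (m.+1 <= d./2)%N)
        (delta_mx (rev_ord m) m - delta_mx m (rev_ord m)).

(* Main.v *)
Require Import Defs.
From HB Require Import structures.
From mathcomp Require Import all_boot all_order all_algebra.
From mathcomp Require Import perm complex reals.
From mathcomp Require Import ring zify.
Import Order.TTheory GRing.Theory Num.Theory.
Local Open Scope ring_scope.
Set Implicit Arguments.
Unset Strict Implicit.

(** Write [A^T = -A] as [A = P D Q^T = - Q D^-1 P^T], where [P = A_+] and
    [Q = A_-^T] are polynomial and invertible on the closed disk.  By a
    rigidity argument (the roots of [det P] lie outside the disk, those of the
    reversed [det P] inside) the quotient [W = - P^-1 Q] is a polynomial matrix,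
    so that [A = P (W D^-1) P^T] with [W i j (z) = - z^(k_i + k_j) W j i (1/z)].
    Hence [W i j] vanishes if [k_i + k_j < 0] and is constant if
    [k_i + k_j = 0]; these constants form a skew matrix [W0] with
    [det W = det W0 <> 0], which forces the indices to be symmetric.  The ratio
    [W W0^-1] is unipotent and self-adjoint for the form [W0 D^-1], so its
    square root [V], a polynomial in it, satisfies
    [W D^-1 = V (W0 D^-1) V^T].  It remains to bring the constant matrix [W0] to
    antidiagonal form by symplectic Gram-Schmidt, within the matrices commuting
    with [D].

    If [A] is real, then [conj P = P U] with [U] polynomial, again by rigidity,
    and [P] can be replaced beforehand by the real matrix
    [a P + conj (a P) = P (a + conj a U)] for a suitable scalar [a]. *)

(** * Laurent identities between polynomials *)

(** The reciprocal polynomial: it turns [p.[z^-1]] into a polynomial in [z], up to a power of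
    [z]. *)
Definition revp (F : fieldType) (p : {poly F}) : {poly F} :=
  \poly_(i < size p) p`_((size p).-1 - i).

Lemma horner_revp (F : fieldType) (p : {poly F}) (z : F) :
  z != 0 -> (revp p).[z] = z ^+ (size p).-1 * p.[z^-1].
Proof.
move=> z0; rewrite horner_poly horner_coef mulr_sumr.
rewrite (reindex_inj rev_ord_inj) /=; apply: eq_bigr => i _.
have ip : (i < size p)%N by [].
rewrite (_ : size p - i.+1 = (size p).-1 - i)%N; last by lia.
have ip' : (i <= (size p).-1)%N by lia.
rewrite subKn // exprVn mulrCA; congr (_ * _).
by rewrite expfB_cond // (negPf z0).
Qed.

Lemma revp_eq0 (F : fieldType) (p : {poly F}) : (revp p == 0) = (p == 0).
Proof.
apply/eqP/eqP => [p0|->]; last by rewrite /revp size_poly0 poly_def big_ord0.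
apply/eqP; apply: contra_eqT p0 => p0; apply/eqP => /polyP/(_ 0%N).
rewrite coef_poly coef0 size_poly_gt0 p0 subn0 => /eqP.
by rewrite lead_coef_eq0 (negPf p0).
Qed.

Lemma size_revp (F : fieldType) (p : {poly F}) : (size (revp p) <= size p)%N.
Proof. exact: size_poly. Qed.

(** In characteristic zero the positive integers are infinitely many test points. They are moreover
    nonzero and real, which the later uses rely on. *)
Lemma poly_nat_nonroot (F : numFieldType) (p : {poly F}) :
  p != 0 -> exists n : nat, p.[n.+1%:R] != 0.
Proof.
move=> p0.
have [/allP rp|/allPn[_ /mapP[n _ ->] ?]] :=
  boolP (all (root p) [seq n.+1%:R | n <- iota 0 (size p)]); last by exists n.
have := max_poly_roots p0 (rs := [seq n.+1%:R | n <- iota 0 (size p)]).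
rewrite size_map size_iota ltnn; case/(_ _ _)/implyP => //; first exact/allP.
rewrite map_inj_uniq ?iota_uniq // => m n /eqP.
by rewrite eqr_nat eqSS => /eqP.
Qed.

Lemma poly_eq_punctured (F : numFieldType) (p q : {poly F}) :
  (forall z : F, z != 0 -> p.[z] = q.[z]) -> p = q.
Proof.
move=> pq; apply/eqP; rewrite -subr_eq0; apply/negP => /negP /poly_nat_nonroot.
by case=> n; rewrite !hornerE pq ?subrr ?eqxx // pnatr_eq0.
Qed.

(* The factors [r] and [s] vanish at finitely many points only. *)
Lemma laurent_cancel (F : numFieldType) (p q r s : {poly F}) (n : int) :
    r != 0 -> s != 0 ->
    (forall z : F, z != 0 -> r.[z] * s.[z^-1] * (p.[z] - z ^ n * q.[z^-1]) = 0) ->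
  forall z, z != 0 -> p.[z] = z ^ n * q.[z^-1].
Proof.
move=> r0 s0 rs.
have [k [m nE]] : exists k m : nat, n = m%:Z - k%:Z.
  by case: n {rs} => n; [exists 0%N, n | exists n.+1, 0%N]; rewrite ?NegzE; lia.
(* [t] is the Laurent polynomial [p(z) - z^n q(1/z)] cleared of its negative powers. *)
pose t := 'X^(k + (size q).-1) * p - 'X^m * revp q.
have tE z : z != 0 ->
    t.[z] = z ^+ (k + (size q).-1) * (p.[z] - z ^ n * q.[z^-1]).
  move=> z0; rewrite !hornerE horner_revp // mulrBr nE expfzDr //.
  rewrite -exprnN -exprnP exprD; move: (expf_neq0 k z0) p.[z].
  by move: (z ^+ k) (z ^+ m) (z ^+ _) q.[_] => a b c u a0 v; field.
have t0 : t = 0.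
  have: r * revp s * t = 0.
    apply: poly_eq_punctured => z z0; rewrite horner0 !hornerM horner_revp // tE //.
    have := rs _ z0; set a := r.[z]; set b := s.[_]; set c := p.[z] - _ => abc.
    rewrite (_ : a * _ * _ = z ^+ (size s).-1 * z ^+ (k + (size q).-1) * (a * b * c)).
      by rewrite abc mulr0.
    by ring.
  by move/eqP; rewrite !mulf_eq0 revp_eq0 (negPf r0) (negPf s0) => /eqP.
move=> z z0; apply/eqP; rewrite -subr_eq0.
have := tE _ z0; rewrite t0 horner0 => /esym/eqP.
by rewrite mulf_eq0 expf_eq0 (negPf z0) andbF.
Qed.

(** The right side has no power of [z] above [n], so [p] has degree at most [n]; for negative [n]
    this leaves no nonzero [p]. *)
Lemma size_laurent (F : numFieldType) (p q : {poly F}) (n : int) :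
    (forall z : F, z != 0 -> p.[z] = z ^ n * q.[z^-1]) ->
  p != 0 -> (size p)%:Z <= n + 1.
Proof.
move=> pq p0.
have [k [m nE]] : exists k m : nat, n = m%:Z - k%:Z.
  by case: n {pq} => n; [exists 0%N, n | exists n.+1, 0%N]; rewrite ?NegzE; lia.
have E : 'X^(k + (size q).-1) * p = 'X^m * revp q.
  apply: poly_eq_punctured => z z0.
  rewrite !hornerE horner_revp // pq // nE expfzDr // -exprnN -exprnP.
  rewrite exprD; move: (expf_neq0 k z0).
  by move: (z ^+ k) (z ^+ m) (z ^+ _) q.[_] => a b c u a0; field.
have q0 : q != 0.
  apply: contra_neq p0 => q0; apply: poly_eq_punctured => z z0.
  by rewrite pq // q0 !horner0 mulr0.
have := congr1 (fun u : {poly F} => size u) E.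
rewrite (mulrC 'X^(k + _)) (mulrC 'X^m) !size_mulXn ?revp_eq0 //.
have := size_revp q; have : (0 < size q)%N by rewrite size_poly_gt0.
rewrite nE; move: (size q) (size p) (size (revp q)) => a b c; lia.
Qed.

(** * Rigidity of factorizations *)

Local Notation ev z X := (map_mx (horner_eval z) X).

Lemma det_ev (F : comNzRingType) (d : nat) (X : 'M[{poly F}]_d) (z : F) :
  \det (ev z X) = (\det X).[z].
Proof. exact: det_map_mx. Qed.

Lemma scalemx_polyI (F : idomainType) (m n : nat) (p : {poly F})
    (X Y : 'M[{poly F}]_(m, n)) :
  p != 0 -> p *: X = p *: Y -> X = Y.
Proof.
move=> p0 /matrixP XY; apply/matrixP => i j.
by have := XY i j; rewrite !mxE => /(mulfI p0).
Qed.

Section Rigidity.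
Variables (C : numClosedFieldType) (d : nat).
Implicit Types (X P Q : 'M[{poly C}]_d) (kappa : 'I_d -> int).

Definition disk_unit X := forall z : C, `|z| <= 1 -> (\det X).[z] != 0.

Lemma disk_unit_neq0 X : disk_unit X -> \det X != 0.
Proof.
move=> /(_ 0); rewrite normr0 ler01 => /(_ isT).
by apply: contraNneq => ->; rewrite horner0.
Qed.

(* [Dkappa] over an arbitrary field, convertible to it over [R[i]]. *)
Definition Dk kappa (z : C) : 'M[C]_d := diag_mx (\row_m z ^ kappa m).

(* The value at [z] of [P D Q^T], where [^T] transposes and inverts [z]. *)
Definition wh P kappa Q (z : C) :=
  ev z P *m Dk kappa z *m (ev z^-1 Q)^T.

(** Multiply on the left by the adjugate of [P] and on the right by the transposed adjugate of [Q']: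
    both factors become scalar while all entries stay polynomial. *)
Lemma wh_adj P P' Q Q' kappa kappa' (i j : 'I_d) (z : C) :
    wh P kappa Q z = wh P' kappa' Q' z ->
  (\det P).[z] * (z ^ kappa i * ((\adj Q' *m Q) j i).[z^-1]) =
  ((\adj P *m P') i j).[z] * z ^ kappa' j * (\det Q').[z^-1].
Proof.
move=> /(congr1 (fun Y => ev z (\adj P) *m Y *m (ev z^-1 (\adj Q'))^T)).
rewrite /wh !mulmxA -!map_mxM mul_adj_mx map_scalar_mx.
rewrite -!(mulmxA _ (ev z^-1 _)^T) -!trmx_mul -!map_mxM mul_adj_mx map_scalar_mx.
rewrite tr_scalar_mx -mulmxA mul_scalar_mx mul_mx_scalar => /matrixP/(_ i j).
rewrite [LHS]mxE [RHS]mxE mul_diag_mx mul_mx_diag !mxE /= /horner_eval /= => ->.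
by rewrite mulrC.
Qed.

(** The entries of [P^-1 P'] are the quotients [N i j / delta]. By [wh_adj], [delta] divides [N i j]
    times a factor whose roots lie in the open disk; its own roots lie outside the closed disk, so
    it is coprime to that factor. *)
Lemma rigid_factor P P' Q Q' kappa kappa' :
    disk_unit P -> disk_unit Q' ->
    (forall z : C, z != 0 -> wh P kappa Q z = wh P' kappa' Q' z) ->
  exists U : 'M[{poly C}]_d, P *m U = P'.
Proof.
move=> uP uQ' PQ; pose delta := \det P; pose theta := \det Q'.
pose N := \adj P *m P'; pose L := \adj Q' *m Q.
have dvdN i j : delta %| N i j.
  have [k [m nE]] : exists k m : nat, kappa i - kappa' j = m%:Z - k%:Z.
    by case: (kappa i - _) => n; [exists 0%N, n | exists n.+1, 0%N]; rewrite ?NegzE; lia.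
  (* This is [wh_adj] multiplied by a power of [z] that removes all negative exponents. *)
  have E : 'X^(k + (size (L j i)).-1) * revp theta * N i j =
           delta * ('X^(m + (size theta).-1) * revp (L j i)).
    apply: poly_eq_punctured => z z0; rewrite !hornerE !horner_revp //.
    have := wh_adj i j (PQ z z0); rewrite -/delta -/theta -/N -/L.
    have -> : kappa i = (kappa i - kappa' j) + kappa' j by lia.
    rewrite nE !expfzDr // -exprnN -exprnP !exprD.
    have a0 : z ^ kappa' j != 0 by rewrite expfz_neq0.
    have b0 := expf_neq0 k z0; move: a0 b0; rewrite /=.
    move: (z ^ kappa' j) (z ^+ k) (z ^+ m) (z ^+ _.-1) (z ^+ _.-1) => a b c e f.
    move: (N i j).[z] (L j i).[_] delta.[z] theta.[_] => g h r s a0 b0 H.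
    apply: (mulfI a0); transitivity (b * e * f * (g * a * s)); first by ring.
    by rewrite -H; field.
  have : delta %| 'X^(k + (size (L j i)).-1) * revp theta * N i j.
    by rewrite E dvdp_mulr.
  rewrite Gauss_dvdpr //; apply: Pdiv.ClosedField.root_coprimep => x /eqP dx.
  have x1 : 1 < `|x|.
    rewrite real_ltNge ?normr_real //; apply/negP => /uP.
    by rewrite -/delta dx eqxx.
  have x0 : x != 0 by rewrite -normr_gt0 (lt_trans ltr01).
  rewrite !hornerE horner_revp // !mulf_neq0 ?expf_neq0 // uQ' //.
  by rewrite normfV invf_le1 ?ltW // (lt_trans ltr01).
exists (\matrix_(i, j) (N i j %/ delta)).
apply: (scalemx_polyI (disk_unit_neq0 uP)); rewrite scalemxAr.
rewrite (_ : _ *: _ = N) ?mulmxA ?mul_mx_adj ?mul_scalar_mx //.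
by apply/matrixP => i j; rewrite [LHS]mxE [X in _ * X]mxE mulrC divpK.
Qed.

(** Cancelling [P] on the left and [Q'^T] on the right leaves [U D' = D T^T]. The cancelled
    determinants may vanish at some [z], hence the appeal to [laurent_cancel]. *)
Lemma rigid_relation P P' Q Q' U T kappa kappa' (i j : 'I_d) :
    disk_unit P -> disk_unit Q' ->
    (forall z : C, z != 0 -> wh P kappa Q z = wh P' kappa' Q' z) ->
    P *m U = P' -> Q' *m T = Q ->
  forall z : C, z != 0 -> (U i j).[z] = z ^ (kappa i - kappa' j) * (T j i).[z^-1].
Proof.
move=> uP uQ' PQ PU QT.
apply: (laurent_cancel (disk_unit_neq0 uP) (disk_unit_neq0 uQ')) => z z0.
have := wh_adj i j (PQ z z0); rewrite -PU -QT !mulmxA !mul_adj_mx !mul_scalar_mx.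
rewrite [(_ *: U) i j]mxE [(_ *: T) j i]mxE !hornerE => H.
have a0 : z ^ kappa' j != 0 by rewrite expfz_neq0.
apply: (mulfI a0); rewrite mulr0 expfzDr // -invr_expz; move: a0 H.
move: (z ^ kappa' j) (z ^ kappa i) (\det P).[z] (\det Q').[_] => a b p q a0.
move: (_.[_]) (_.[_]) => u t /eqP; rewrite -subr_eq0 => /eqP H.
by rewrite -[RHS]oppr0 -H /=; field.
Qed.

End Rigidity.

(** * Graded skew matrices *)

Section SkewGraded.
Variables (C : numClosedFieldType) (d : nat).
Variables (kappa : 'I_d -> int) (W : 'M[{poly C}]_d).
Hypothesis uW : disk_unit W.
Hypothesis skewW : forall (i j : 'I_d) (z : C), z != 0 ->
  (W i j).[z] = z ^ (kappa i + kappa j) * (- W j i).[z^-1].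

Lemma size_skew_graded (i j : 'I_d) :
  W i j != 0 -> (size (W i j))%:Z <= kappa i + kappa j + 1.
Proof. by apply: size_laurent; apply: skewW. Qed.

Lemma skew_graded_eq0 (i j : 'I_d) : kappa i + kappa j < 0 -> W i j = 0.
Proof.
move=> k0; apply/eqP; apply/negP => /negP W0.
have := size_skew_graded W0; have : (0 < size (W i j))%N by rewrite size_poly_gt0.
by move: (size _) => n; lia.
Qed.

Lemma skew_graded_const (i j : 'I_d) :
  kappa i + kappa j = 0 -> W i j = ((W i j)`_0)%:P.
Proof.
move=> k0; apply: size1_polyC; have [->|W0] := eqVneq (W i j) 0.
  by rewrite size_poly0.
by have := size_skew_graded W0; rewrite k0; move: (size _) => n; lia.
Qed.

Lemma ev_skew_graded (z : C) : z != 0 ->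
  ev z W = - (Dk kappa z *m (ev z^-1 W)^T *m Dk kappa z).
Proof.
move=> z0; apply/matrixP => i j; rewrite mxE [RHS]mxE mul_mx_diag mul_diag_mx !mxE.
by rewrite /horner_eval skewW // hornerN expfzDr // mulrN mulrAC.
Qed.

Lemma det_Dk (z : C) : z != 0 -> \det (Dk kappa z) = z ^ (\sum_i kappa i).
Proof.
move=> z0; rewrite det_diag.
rewrite (big_morph (fun n : int => z ^ n) (fun m n => expfzDr m n z0) (expr0z z)).
by apply: eq_bigr => i _; rewrite mxE.
Qed.

Lemma det_skew_graded (z : C) : z != 0 ->
  (\det W).[z] = (-1) ^+ d * (z ^ (\sum_i kappa i)) ^+ 2 * (\det W).[z^-1].
Proof.
move=> z0; rewrite -!det_ev {1}ev_skew_graded // -scaleN1r detZ !det_mulmx det_Dk //.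
by rewrite det_tr; move: ((-1) ^+ d) (z ^ _) (\det _) => a b c; ring.
Qed.

(** A root [x] would lie outside the closed disk, and the functional equation would make [1/x],
    which lies inside, a root as well. *)
Lemma det_skew_graded_const : exists2 c : C, c != 0 & \det W = c%:P.
Proof.
have : size (\det W) == 1.
  apply/negPn/negP => /closed_rootP[x /eqP x0].
  have [x1|x1] := boolP (`|x| <= 1); first by have := uW x1; rewrite x0 eqxx.
  have {}x1 : 1 < `|x| by rewrite real_ltNge ?normr_real.
  have xn0 : x != 0 by rewrite -normr_gt0 (lt_trans ltr01).
  have /uW : `|x^-1| <= 1 by rewrite normfV invf_le1 ?ltW // (lt_trans ltr01).
  apply/negP/negPn; move: x0; rewrite (det_skew_graded xn0) => /eqP.
  by rewrite !mulf_eq0 expf_eq0 oppr_eq0 oner_eq0 andbF /= expfz_eq0 (negPf xn0) !andbF.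
by move/size_poly1P => [c c0 ->]; exists c.
Qed.

(** At [z = 1] the functional equation of the constant determinant reads [c = (-1)^d c]. *)
Lemma skew_graded_even : ~~ odd d.
Proof.
have [c c0 detW] := det_skew_graded_const.
have := det_skew_graded (oner_neq0 C); rewrite detW !hornerC exp1rz expr1n mulr1.
move/eqP; rewrite -[X in X == _]mul1r (inj_eq (mulIf c0)) -signr_odd.
case: (odd d) => //=; rewrite expr1 -subr_eq0 opprK.
by rewrite (_ : 1 + 1 = 2%:R) // pnatr_eq0.
Qed.

Lemma skew_graded_sum0 : \sum_i kappa i = 0.
Proof.
have [c c0 detW] := det_skew_graded_const.
(* The point 2 is not a root of unity, so the power of 2 left by the functional equation equals 1
   only for exponent zero. *)
have z0 : 2%:R != 0 :> C by rewrite pnatr_eq0.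
have := det_skew_graded z0; rewrite detW !hornerC -signr_odd (negPf skew_graded_even).
rewrite expr0 mul1r => /eqP; rewrite -[X in X == _]mul1r (inj_eq (mulIf c0)) expr2.
rewrite -expfzDr // eq_sym pexprz_eq1 ?ler0n // (eqr_nat C 2 1) orbF => /eqP; lia.
Qed.

Definition skew_lead : 'M[C]_d :=
  \matrix_(i, j) if kappa i + kappa j == 0 then (W i j)`_0 else 0.

Lemma skew_lead_neq0 (i j : 'I_d) : skew_lead i j != 0 -> kappa j = - kappa i.
Proof. by rewrite mxE; case: ifP => [/eqP/addr0_eq <- //|_]; rewrite eqxx. Qed.

Lemma tr_skew_lead : skew_lead^T = - skew_lead.
Proof.
apply/matrixP => i j; rewrite !mxE addrC; case: eqP => k0; rewrite ?oppr0 //.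
have k0' : kappa j + kappa i = 0 by rewrite addrC.
have := skewW j i (oner_neq0 C); rewrite k0' expr0z mul1r.
by rewrite (skew_graded_const k0) (skew_graded_const k0') hornerN !hornerC !coefC.
Qed.

(* A nonzero term of the Leibniz expansion has [kappa i + kappa (s i) >= 0]
   for all [i], and these numbers sum to zero. *)
Lemma skew_graded_perm (s : 'S_d) :
    (forall i, 0 <= kappa i + kappa (s i)) ->
  forall i, kappa (s i) = - kappa i.
Proof.
move=> ge0 i; have : \sum_i (kappa i + kappa (s i)) = 0.
  rewrite big_split /= skew_graded_sum0 add0r.
  by rewrite -[RHS]skew_graded_sum0 [RHS](reindex_inj (@perm_inj _ s)).
move/eqP; rewrite psumr_eq0 // => /allP /(_ i (mem_index_enum i)) /eqP.
lia.
Qed.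

(** The Leibniz expansions agree term by term: if some [kappa i + kappa (s i)] is negative both
    terms vanish, and otherwise all these sums are zero and the factors are the constants kept in
    [skew_lead]. *)
Lemma det_skew_lead : \det W = (\det skew_lead)%:P.
Proof.
rewrite [in RHS]/determinant rmorph_sum; apply: eq_bigr => s _.
rewrite rmorphM rmorph_sign rmorph_prod /=; congr (_ * _).
have [/forallP ge0|/forallPn /=] := boolP [forall i, 0 <= kappa i + kappa (s i)].
  apply: eq_bigr => i _; rewrite mxE skew_graded_perm // subrr eqxx.
  by apply: skew_graded_const; rewrite skew_graded_perm ?subrr.
case=> i; rewrite -ltNge => lt0; rewrite (bigD1 i) //= (skew_graded_eq0 lt0) mul0r.
by rewrite (bigD1 i) //= mxE lt_eqF // polyC0 mul0r.
Qed.

Lemma skew_lead_unit : skew_lead \in unitmx.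
Proof.
rewrite unitmxE unitfE -polyC_eq0 -det_skew_lead.
by have [c c0 ->] := det_skew_graded_const; rewrite polyC_eq0.
Qed.

(** Were there no such permutation, each Leibniz term of [\det W] would contain a zero factor. *)
Lemma skew_kappa_perm : exists s : 'S_d, forall i, kappa (s i) = - kappa i.
Proof.
have : \det W != 0 by have [c c0 ->] := det_skew_graded_const; rewrite polyC_eq0.
have [/existsP[s /forallP ge0] _|/existsPn no] :=
  boolP [exists s : 'S_d, [forall i, 0 <= kappa i + kappa (s i)]].
  by exists s; apply: skew_graded_perm.
rewrite /determinant big1 ?eqxx // => s _; have /forallPn /= := no s.
by case=> i; rewrite -ltNge => lt0; rewrite (bigD1 i) //= (skew_graded_eq0 lt0) mul0r mulr0.
Qed.

End SkewGraded.

(** * Symmetry of the indices and unipotent square roots *)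

Lemma perm_eq_map_inj (T : finType) (T' : eqType) (f : T -> T') (g : T -> T) :
  injective g -> perm_eq [seq f (g i) | i <- enum T] [seq f i | i <- enum T].
Proof.
move=> gI; rewrite (map_comp f g); apply/perm_map/uniq_perm.
- by rewrite map_inj_uniq ?enum_uniq.
- by rewrite enum_uniq.
move=> x; rewrite mem_enum inE; apply/mapP; exists (invF gI x); rewrite ?f_invF //.
by rewrite mem_enum.
Qed.

Lemma sorted_map_enum_ord (d : nat) (f : 'I_d -> int) :
    (forall i j : 'I_d, (i <= j)%N -> f i <= f j) ->
  sorted <=%O [seq f i | i <- enum 'I_d].
Proof.
move=> fmono; apply: (homo_sorted (e := relpre val leq)) => //.
by rewrite -sorted_map val_enum_ord iota_sorted.
Qed.

(** Both sides are nondecreasing in [i] and list the same values with multiplicity, so they are the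
    same sequence. *)
Lemma sorted_kappa_rev (d : nat) (kappa : 'I_d -> int) (s : 'S_d) :
    (forall m m' : 'I_d, (m <= m')%N -> kappa m' <= kappa m) ->
    (forall i, kappa (s i) = - kappa i) ->
  forall i, kappa (rev_ord i) = - kappa i.
Proof.
move=> kmono ks.
have /eq_in_map E : [seq kappa (rev_ord i) | i <- enum 'I_d] =
                    [seq - kappa i | i <- enum 'I_d].
  apply: (sorted_eq le_trans le_anti).
  - by apply: sorted_map_enum_ord => i j ij; apply: kmono; rewrite leq_sub2l.
  - by apply: sorted_map_enum_ord => i j ij; rewrite lerN2 kmono.
  - apply: perm_trans (perm_eq_map_inj _ rev_ord_inj) _; rewrite perm_sym.
    by rewrite -(eq_map ks); apply: perm_eq_map_inj; apply: perm_inj.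
by move=> i; apply: E; rewrite mem_enum.
Qed.

(** Truncations of the Taylor series of the square root of [1 + X], built one coefficient at a time.
    The coefficients are rational, hence fixed by every field endomorphism. *)
Lemma sqrt_series (n : nat) :
  exists s r : {poly rat}, s ^+ 2 = 1 + 'X + 'X^(n.+1) * r /\ s.[0] = 1.
Proof.
elim: n => [|n [s [r [sE s0]]]].
  by exists 1, (-1); rewrite expr1n expr1 mulrN1 addrK hornerC.
(* Chosen so that the new remainder vanishes at 0: as [s.[0] = 1], its value there is [r.[0] + 2
   c]. *)
pose c : rat := - r.[0] / 2%:R.
have [q qE] : exists q, r + (2%:R * c) *: s + (c ^+ 2) *: 'X^(n.+1) = q * ('X - 0%:P).
  by apply/factor_theorem/eqP; rewrite !hornerE s0 /c expr0n /=; field.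
move: c qE => c qE; exists (s + c *: 'X^(n.+1)), q; split; last first.
  by rewrite !hornerE s0 expr0n /= mulr0 addr0.
have -> : 'X^(n.+2) * q = 'X^(n.+1) * (q * ('X - 0%:P)).
  by rewrite polyC0 subr0 exprSr -mulrA (mulrC 'X).
rewrite -qE sqrrD sE -!mul_polyC polyCM polyC_exp polyCMn polyC1.
ring.
Qed.

Lemma unipotent_sqrt (K : comNzRingType) (f : {rmorphism rat -> K}) (n N : nat)
    (Z : 'M[K]_n.+1) : Z ^+ N = 0 ->
  exists s : {poly rat},
    horner_mx Z (map_poly f s) *m horner_mx Z (map_poly f s) = 1%:M + Z.
Proof.
move=> ZN; have [s [r [sE _]]] := sqrt_series N; exists s.
rewrite -[_ *m _]/(_ * _) -rmorphM -rmorphM -expr2 sE !rmorphD !rmorphM /= !rmorph1.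
by rewrite map_polyXn rmorphXn /= !map_polyX !horner_mx_X exprS ZN mulr0 mul0r addr0.
Qed.

Lemma horner_mx_intertwine (K : comNzRingType) (n : nat) (Z H Y : 'M[K]_n.+1)
    (p : {poly K}) :
  Z *m H = H *m Y^T -> horner_mx Z p *m H = H *m (horner_mx Y p)^T.
Proof.
move=> ZH; elim/poly_ind: p => [|p c IH].
  by rewrite !rmorph0 trmx0 mul0mx mulmx0.
rewrite [in RHS]mulrC !rmorphD !rmorphM /= !horner_mx_X !horner_mx_C.
rewrite linearD /= tr_scalar_mx trmx_mul mulmxDl mulmxDr scalar_mxC; congr (_ + _).
by rewrite -mulmxA ZH !mulmxA IH.
Qed.

(** Each factor [Z] lowers [kappa] by at least one, while the total drop is at most twice the
    largest absolute value of [kappa]. *)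
Lemma graded_nilpotent (K : pzRingType) (n : nat) (kappa : 'I_n.+1 -> int)
    (Z : 'M[K]_n.+1) :
  (forall i j, Z i j != 0 -> kappa j < kappa i) -> exists N, Z ^+ N = 0.
Proof.
move=> gZ.
have gZm m i j : (Z ^+ m) i j != 0 -> kappa j + m%:Z <= kappa i.
  elim: m i j => [|m IH] i j.
    by rewrite expr0 mxE addr0; have [->|_] := eqVneq i j; rewrite ?lexx ?mulr0n ?eqxx.
  rewrite exprSr mxE => /eqP nz.
  have /existsP[k] : [exists k, (Z ^+ m) i k * Z k j != 0].
    apply: contra_notT nz => /existsPn nz; apply: big1 => k _.
    by apply/eqP; have := nz k; rewrite negbK.
  have [->|/IH a] := eqVneq ((Z ^+ m) i k) 0; first by rewrite mul0r eqxx.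
  have [->|/gZ b _] := eqVneq (Z k j) 0; first by rewrite mulr0 eqxx.
  lia.
exists (\max_i `|kappa i|%N).*2.+1; apply/matrixP => i j; rewrite [RHS]mxE.
apply/eqP; apply/negP => /negP /gZm.
have := leq_bigmax (F := fun i => `|kappa i|%N) i.
have := leq_bigmax (F := fun i => `|kappa i|%N) j.
lia.
Qed.

(** * Normal form of constant skew matrices *)

Definition graded (F : nmodType) (m n : nat) (f : 'I_m -> int) (g : 'I_n -> int)
  (A : 'M[F]_(m, n)) := forall i j, A i j != 0 -> f i = g j.

Lemma graded_mul (F : pzSemiRingType) (m n p : nat) (f : 'I_m -> int)
    (g : 'I_n -> int) (h : 'I_p -> int) (A : 'M[F]_(m, n)) (B : 'M[F]_(n, p)) :
  graded f g A -> graded g h B -> graded f h (A *m B).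
Proof.
move=> gA gB i j AB; apply/eqP; apply: contraNT AB => fh; rewrite mxE big1 // => k _.
have [->|/gA fg] := eqVneq (A i k) 0; first by rewrite mul0r.
have [->|/gB gh] := eqVneq (B k j) 0; first by rewrite mulr0.
by rewrite fg gh eqxx in fh.
Qed.

(** Restating the support condition as an intertwining identity lets it pass to inverses. *)
Lemma graded_comm (F : numFieldType) (m n : nat) (f : 'I_m -> int) (g : 'I_n -> int)
    (A : 'M[F]_(m, n)) :
  graded f g A <-> diag_mx (\row_i (f i)%:~R) *m A = A *m diag_mx (\row_i (g i)%:~R).
Proof.
rewrite mul_diag_mx mul_mx_diag; split=> [gA|/matrixP gA i j A0].
  apply/matrixP => i j; rewrite !mxE mulrC.
  by have [->|/gA ->] := eqVneq (A i j) 0; rewrite ?mul0r.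
by have := gA i j; rewrite !mxE mulrC => /(mulfI A0)/intr_inj.
Qed.

Lemma graded_inv (F : numFieldType) (n : nat) (f g : 'I_n -> int) (A : 'M[F]_n) :
  A \in unitmx -> graded f g A -> graded g f (invmx A).
Proof.
move=> uA /graded_comm gA; apply/graded_comm.
by rewrite -[X in X *m invmx A](mulKmx uA) -gA !mulmxA mulmxK.
Qed.

Section SkewNormalForm.
Variables (F : numFieldType) (d : nat) (kappa : 'I_d -> int).
Variables (rho : 'I_d -> 'I_d) (e : 'I_d -> F).
Hypothesis rhoK : involutive rho.
Hypothesis rho_neq : forall i, rho i != i.
Hypothesis kappa_rho : forall i, kappa (rho i) = - kappa i.
Hypothesis e_neq0 : forall i, e i != 0.
Hypothesis e_rho : forall i, e (rho i) = - e i.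
Implicit Types (B G : 'M[F]_d) (T : {set 'I_d}).

Definition pairing : 'M[F]_d := \matrix_(i, j) if j == rho i then e i else 0.

Definition skew_kappa B :=
  [/\ B^T = - B, B \in unitmx & graded kappa (fun j => - kappa j) B].

(** [T] is the [rho]-stable set of indices already split off by Gram-Schmidt. Only rows are
    prescribed; for skew [B] the columns follow. *)
Definition normal_on T B :=
  forall i, i \in T -> rho i \in T /\ forall j, B i j = pairing i j.

Let gr G := graded kappa kappa G.

Lemma skew_kappa_cong B G : G \in unitmx -> gr G ->
  skew_kappa B -> skew_kappa (G *m B *m G^T).
Proof.
move=> uG gG [sB uB gB]; split.
- by rewrite !trmx_mul trmxK sB mulNmx mulmxN mulmxA.
- by rewrite !unitmx_mul unitmx_tr uG uB.
apply: graded_mul (graded_mul gG gB) _ => i j; rewrite mxE => /gG ->.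
by [].
Qed.

Lemma skew_entry B i j : skew_kappa B -> B j i = - B i j.
Proof. by case=> /matrixP/(_ i j); rewrite !mxE. Qed.

Lemma skew_diag B i : skew_kappa B -> B i i = 0.
Proof.
move=> /(skew_entry i i)/eqP; rewrite -subr_eq0 opprK -mulr2n mulrn_eq0.
by move/eqP.
Qed.

Lemma skew_kappa_row B i : skew_kappa B -> exists j, B i j != 0.
Proof.
case=> _ uB _; apply/existsP; apply: contraTT uB => /existsPn B0.
rewrite unitmxE unitfE negbK (expand_det_row _ i) big1 // => j _.
by have := B0 j; rewrite negbK => /eqP ->; rewrite mul0r.
Qed.

(** Pivoting: a nonzero entry of row [i] sits in a column [j] with [kappa j = kappa (rho i)], so
    exchanging [j] and [rho i] respects the grading. Both indices lie outside [T], so the treated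
    rows survive. *)
Lemma normal_swap T B i : skew_kappa B -> normal_on T B -> i \notin T ->
  exists G, [/\ G \in unitmx, gr G, normal_on T (G *m B *m G^T) &
                (G *m B *m G^T) i (rho i) != 0].
Proof.
move=> sB nB iT; have [j Bij] := skew_kappa_row i sB.
have rT : rho i \notin T.
  by apply: contra iT => /nB[]; rewrite rhoK.
have ji : j != i by apply: contraNneq Bij => ->; rewrite skew_diag.
(* A treated row [j] is nonzero only at [rho j], which would put [i = rho j] in [T]. *)
have jT : j \notin T.
  apply: contra Bij => jT; have [rjT nj] := nB j jT.
  rewrite (skew_entry j i sB) nj mxE; case: (i =P _) => [ij|_]; last by rewrite oppr0.
  by move: iT; rewrite ij rjT.
have kj : kappa j = kappa (rho i).
  by have [_ _ /(_ _ _ Bij)] := sB; rewrite kappa_rho; lia.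
pose s := tperm j (rho i).
have ks k : kappa (s k) = kappa k by rewrite /s; case: tpermP => // ->.
have sT k : k \in T -> s k = k.
  by move=> kT; rewrite /s tpermD //; apply: contraTneq kT => <-.
have BE k l : (perm_mx s *m B *m (perm_mx s)^T) k l = B (s k) (s l).
  by rewrite tr_perm_mx -row_permE -col_permE !mxE.
exists (perm_mx s); split; first exact: unitmx_perm.
- by move=> k l; rewrite !mxE; case: (s k =P l) => [<-|]; rewrite ?ks // eqxx.
- move=> k kT; have [rkT nk] := nB k kT; split=> // l.
  by rewrite BE sT // nk !mxE -{1}(sT _ rkT) (inj_eq perm_inj).
- by rewrite BE tpermR /s tpermD // eq_sym.
Qed.

Lemma normal_scale T B i : normal_on T B -> i \notin T -> B i (rho i) != 0 ->
  exists G, [/\ G \in unitmx, gr G, normal_on T (G *m B *m G^T) &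
                (G *m B *m G^T) i (rho i) = e i].
Proof.
move=> nB iT B0.
have rT : rho i \notin T.
  by apply: contra iT => /nB[]; rewrite rhoK.
pose t k := if k == rho i then e i / B i (rho i) else 1.
have t0 k : t k != 0.
  by rewrite /t; case: ifP => _; rewrite ?oner_eq0 // mulf_neq0 // invr_eq0.
have tT k : k \in T -> t k = 1.
  by move=> kT; rewrite /t; case: eqP => // kr; rewrite -kr kT in rT.
pose G : 'M[F]_d := diag_mx (\row_k t k).
have BE k l : (G *m B *m G^T) k l = t k * B k l * t l.
  by rewrite tr_diag_mx mul_mx_diag mxE mul_diag_mx !mxE.
exists G; split.
- by rewrite unitmxE unitfE det_diag; apply/prodf_neq0 => k _; rewrite mxE.
- by move=> k l; rewrite !mxE; case: (k =P l) => [->|]; rewrite // mulr0n eqxx.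
- move=> k kT; have [rkT nk] := nB k kT; split=> // l.
  rewrite BE nk tT // mul1r !mxE; case: eqP => [->|_]; last by rewrite mul0r.
  by rewrite tT ?mulr1.
- rewrite BE /t eqxx ifN; last by rewrite eq_sym.
  by rewrite mul1r mulrC divfK.
Qed.

Lemma normal_clear T B i : skew_kappa B -> normal_on T B -> i \notin T ->
    B i (rho i) = e i ->
  exists G, [/\ G \in unitmx, gr G & normal_on (i |: (rho i |: T)) (G *m B *m G^T)].
Proof.
move=> sB nB iT Bi; set p := rho i.
have ip : i != p by rewrite eq_sym rho_neq.
have Bp : B p i = - e i by rewrite (skew_entry i p sB) Bi.
have ei := e_neq0 i.
(* Adding [a k] times vector [i] and [b k] times vector [p] to vector [k] makes it orthogonal to
   both; the pair itself is left alone. *)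
pose a k := if (k == i) || (k == p) then 0 else - B k p / e i.
pose b k := if (k == i) || (k == p) then 0 else B k i / e i.
have off k : k \in T -> (i == rho k) = false /\ (p == rho k) = false.
  move=> kT; have [rkT _] := nB k kT.
  split; first by apply: contraNF iT => /eqP ->.
  by rewrite (inj_eq (inv_inj rhoK)); apply: contraNF iT => /eqP ->.
have [ai ap] : a i = 0 /\ a p = 0 by rewrite /a !eqxx orbT.
have [bi bp] : b i = 0 /\ b p = 0 by rewrite /b !eqxx orbT.
have aT k : k \in T -> a k = 0 /\ b k = 0.
  move=> kT; have [rkT nk] := nB k kT; have [irk prk] := off k kT.
  by rewrite /a /b !nk !mxE irk prk !mul0r oppr0 mul0r !if_same.
(* Since [a] and [b] vanish at [i] and [p], these matrices compose additively in [c], so [act (-1)]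
   inverts [act 1]. *)
pose act c : 'M[F]_d := \matrix_(k, l)
  ((k == l)%:R + c * a k * (l == i)%:R + c * b k * (l == p)%:R).
have actE c X k l : (act c *m X) k l = X k l + c * a k * X i l + c * b k * X p l.
  have dl (q : 'I_d) (r : F) : \sum_j r * (j == q)%:R * X j l = r * X q l.
    rewrite (bigD1 q) //= eqxx mulr1 big1 ?addr0 // => j /negPf ->.
    by rewrite mulr0 mul0r.
  rewrite mxE; under eq_bigr do rewrite mxE !mulrDl.
  rewrite !big_split /= !dl; congr (_ + _ + _).
  by under eq_bigr do rewrite eq_sym -[_%:R]mul1r; rewrite dl mul1r.
have BE k l : (act 1 *m B *m (act 1)^T) k l =
  B k l + a k * B i l + b k * B p l + a l * (B k i + b k * B p i)
  + b l * (B k p + a k * B i p).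
  transitivity ((act 1 *m (act 1 *m B)^T) l k).
    by rewrite -[X in (X *m (_ *m _)^T) _ _]trmxK -trmx_mul [RHS]mxE.
  rewrite actE ![_^T _ _]mxE !actE.
  by rewrite !mul1r (skew_diag i sB) (skew_diag p sB) !mulr0 !addr0.
exists (act 1); split.
- suff /mulmx1_unit[] : act 1 *m act (-1) = 1%:M by [].
  apply/matrixP => k l; rewrite actE !mxE ai ap bi bp.
  by rewrite !(mulr0, mul0r, addr0) (eq_sym l i) (eq_sym l p); ring.
- move=> k l; rewrite mxE !mul1r; have [->//|kl] := eqVneq k l.
  have [->|li] := eqVneq l i; last first.
    rewrite mulr0 !add0r; have [->|lp] := eqVneq l p; last by rewrite mulr0 eqxx.
    rewrite mulr1 /b; case: ifP; rewrite ?eqxx // => _ bk.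
    have : B k i != 0 by apply: contraNneq bk => ->; rewrite mul0r.
    by have [_ _ gB] := sB; move/gB; rewrite /p kappa_rho; lia.
  rewrite (negPf ip) mulr0 addr0 add0r mulr1 /a; case: ifP; rewrite ?eqxx // => _ ak.
  have : B k p != 0 by apply: contraNneq ak => ->; rewrite oppr0 mul0r.
  by have [_ _ gB] := sB; move/gB; rewrite /p kappa_rho; lia.
move=> k; rewrite !in_setU1 => kT.
have [ak bk] : a k = 0 /\ b k = 0 by case/or3P: kT => [/eqP->|/eqP->|/aT].
split.
  case/or3P: kT => [/eqP->|/eqP->|/nB[-> _]]; rewrite ?eqxx ?orbT //.
  by rewrite /p rhoK eqxx.
move=> l; rewrite BE ak bk !mul0r !addr0 mxE.
case/or3P: kT => [/eqP->|/eqP->|kT].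
- rewrite (skew_diag i sB) mulr0 addr0 -/p Bi; have [->|lp] := eqVneq l p.
    by rewrite bp mul0r addr0.
  rewrite /b (negPf lp) orbF; have [->|li] := eqVneq l i.
    by rewrite mul0r addr0 skew_diag.
  by rewrite divfK // (skew_entry i l sB) subrr.
- rewrite (skew_diag p sB) mulr0 addr0 Bp /p rhoK -/p; have [->|li] := eqVneq l i.
    by rewrite ai mul0r addr0 e_rho.
  rewrite /a (negPf li) /=; have [->|lp] := eqVneq l p.
    by rewrite mul0r addr0 skew_diag.
  by rewrite mulNr mulrNN divfK // (skew_entry p l sB) subrr.
- have [_ nk] := nB k kT; have [irk prk] := off k kT; rewrite !nk !mxE irk prk.
  by rewrite !mulr0 !addr0.
Qed.

(** Symplectic Gram-Schmidt, by induction on the number of untreated indices: each round of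
    swapping, scaling and clearing adds a pair [i], [rho i] to [T]. *)
Lemma skew_normal_form B : skew_kappa B ->
  exists S, [/\ S \in unitmx, gr S & B = S *m pairing *m S^T].
Proof.
move=> sB.
suff [G [uG gG nG]] : exists G, [/\ G \in unitmx, gr G & G *m B *m G^T = pairing].
  exists (invmx G); split; [by rewrite unitmx_inv | exact: graded_inv|].
  by rewrite -nG !mulmxA mulVmx // mul1mx trmx_inv mulmxK // unitmx_tr.
have : normal_on set0 B by move=> i; rewrite inE.
move: {2}#|_| (leqnn #|~: (set0 : {set 'I_d})|) => n.
move: set0 => T; elim: n T B sB => [|n IH] T B sB cT nB.
  exists 1%:M; split; first exact: unitmx1.
    by move=> i j; rewrite mxE; case: (i =P j) => [->|]; rewrite ?mulr0n ?eqxx.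
  rewrite mul1mx trmx1 mulmx1; apply/matrixP => i j.
  have [|_ //] := nB i; move: cT; rewrite leqn0 cards_eq0 => /eqP/setP/(_ i).
  by rewrite !inE => /negbFE.
have [/existsP[i iT]|/existsPn allT] := boolP [exists i, i \notin T]; last first.
  apply: (IH T) => //; rewrite (_ : ~: T = set0) ?cards0 //.
  by apply/setP => i; rewrite !inE; apply/negbTE/allT.
have comp G1 B1 : G1 \in unitmx -> gr G1 -> B1 = G1 *m B *m G1^T ->
    (exists G, [/\ G \in unitmx, gr G & G *m B1 *m G^T = pairing]) ->
  exists G, [/\ G \in unitmx, gr G & G *m B *m G^T = pairing].
  move=> u1 g1 -> [G [uG gG E]]; exists (G *m G1).
  rewrite unitmx_mul uG u1 trmx_mul -E !mulmxA; split=> //; exact: graded_mul gG g1.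
have [G1 [u1 g1 n1 nz1]] := normal_swap sB nB iT.
have [G2 [u2 g2 n2 E2]] := normal_scale n1 iT nz1.
have s2 := skew_kappa_cong u2 g2 (skew_kappa_cong u1 g1 sB).
have [G3 [u3 g3 n3]] := normal_clear s2 n2 iT E2.
apply: (comp (G3 *m (G2 *m G1)) _ _ _ erefl).
- by rewrite !unitmx_mul u1 u2 u3.
- by apply: graded_mul g3 (graded_mul g2 g1).
apply: (IH (i |: (rho i |: T))).
- by apply: skew_kappa_cong; rewrite ?unitmx_mul ?u1 ?u2 ?u3 //;
     apply: graded_mul g3 (graded_mul g2 g1).
- rewrite -ltnS (leq_trans _ cT) // proper_card // properC.
  by apply/properP; split; [apply/subsetP => k kT; rewrite !inE kT !orbT
                          | exists i; rewrite // !inE eqxx].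
by rewrite !trmx_mul !mulmxA; rewrite !mulmxA in n3.
Qed.

End SkewNormalForm.

(** * Square root of the graded part *)

Lemma Dk_mul (C : numClosedFieldType) (d : nat) (kappa : 'I_d -> int) (z : C) :
  z != 0 -> Dk kappa z *m Dk (fun i => - kappa i) z = 1%:M.
Proof.
move=> z0; apply/matrixP => i j; rewrite mul_diag_mx !mxE.
case: (i =P j) => [->|_]; last by rewrite !mulr0n mulr0.
by rewrite !mulr1n -expfzDr // subrr.
Qed.

Lemma graded_Dk (C : numClosedFieldType) (d : nat) (f g : 'I_d -> int)
    (A : 'M[C]_d) (z : C) : graded f g A -> Dk f z *m A = A *m Dk g z.
Proof.
move=> gA; rewrite mul_diag_mx mul_mx_diag; apply/matrixP => i j; rewrite !mxE mulrC.
by have [->|/gA ->] := eqVneq (A i j) 0; rewrite ?mul0r.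
Qed.

Section SkewSquareRoot.
Variables (C : numClosedFieldType) (n : nat).
Local Notation d := n.+1.
Variables (kappa : 'I_d -> int) (W : 'M[{poly C}]_d).
Hypothesis uW : disk_unit W.
Hypothesis skewW : forall (i j : 'I_d) (z : C), z != 0 ->
  (W i j).[z] = z ^ (kappa i + kappa j) * (- W j i).[z^-1].

Let W0 := skew_lead kappa W.
Let Z : 'M[{poly C}]_d := W *m map_mx polyC (invmx W0) - 1%:M.

Let uW0 : W0 \in unitmx. Proof. exact: skew_lead_unit. Qed.

Lemma graded_skew_lead : graded kappa (fun j => - kappa j) W0.
Proof. by move=> i j /skew_lead_neq0 ->; rewrite opprK. Qed.

Let one_addZ : 1%:M + Z = W *m map_mx polyC (invmx W0).
Proof. by rewrite addrC subrK. Qed.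

(** Write [Z = (W - W0) W0^-1]. The first factor lives where [kappa i + kappa k > 0], the second
    where [kappa k = - kappa j], so [Z] strictly lowers [kappa]. *)
Lemma skew_ratio_nilpotent : exists N, Z ^+ N = 0.
Proof.
apply: (graded_nilpotent (kappa := kappa)) => i j.
have -> : Z = (W - map_mx polyC W0) *m map_mx polyC (invmx W0).
  by rewrite mulmxBl -map_mxM mulmxV // map_mx1.
apply: contraNT; rewrite -leNgt => kij; rewrite mxE big1 // => k _.
have [kW|] := ltP 0 (kappa i + kappa k).
  rewrite [X in _ * X]mxE.
  have [->|/(graded_inv uW0 graded_skew_lead)] := eqVneq (invmx W0 k j) 0.
    by rewrite polyC0 mulr0.
  lia.
rewrite !mxE le_eqVlt => /orP[/eqP k0|k0].
  by rewrite k0 eqxx [X in X - _](skew_graded_const skewW k0) subrr mul0r.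
by rewrite (skew_graded_eq0 skewW k0) lt_eqF // polyC0 subr0 mul0r.
Qed.

Lemma ev_one_addZ (z : C) : 1%:M + ev z Z = ev z W *m invmx W0.
Proof.
rewrite -(map_mx1 (horner_eval z)) -map_mxD one_addZ map_mxM; congr (_ *m _).
by rewrite -map_mx_comp map_mx_id // => x; apply: hornerC.
Qed.

(* Hence every polynomial in [Z], such as the square root of [1 + Z], is
   self-adjoint too. *)
Lemma skew_ratio_selfadjoint (z : C) : z != 0 ->
  let H := W0 *m Dk (fun i => - kappa i) z in
  ev z Z *m H = H *m (ev z^-1 Z)^T.
Proof.
move=> z0 H; apply: (addrI H).
transitivity (ev z W *m Dk (fun i => - kappa i) z).
  by rewrite -[X in X + _]mul1mx -mulmxDl ev_one_addZ /H mulmxA mulmxKV.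
rewrite -[X in X + _]mulmx1 -{1}[1%:M]trmx1 -mulmxDr -linearD /= ev_one_addZ.
rewrite trmx_mul trmx_inv.
rewrite /H -(graded_Dk z graded_skew_lead) (ev_skew_graded skewW z0).
rewrite mulNmx -!mulmxA Dk_mul // mulmx1 [W0 *m _]mulmxA.
rewrite (_ : W0 *m invmx W0^T = - 1%:M) ?mulNmx ?mul1mx ?mulmxN //.
by apply: oppr_inj; rewrite -mulNmx -(tr_skew_lead skewW) mulmxV ?unitmx_tr ?opprK.
Qed.

(** With [H = W0 D^-1] and [V] a polynomial in [Z] whose square is [1 + Z], self-adjointness gives
    [V H V^T = V^2 H = W D^-1]. The clause on [phi] will carry realness from [W] to [V]. *)
Lemma skew_square_root :
  exists V : 'M[{poly C}]_d,
    [/\ disk_unit V,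
        forall phi : {rmorphism C -> C},
          map_mx (map_poly phi) W = W -> map_mx (map_poly phi) V = V &
        forall z : C, z != 0 -> ev z W *m Dk (fun i => - kappa i) z =
          ev z V *m (W0 *m Dk (fun i => - kappa i) z) *m (ev z^-1 V)^T].
Proof.
have [N ZN] := skew_ratio_nilpotent.
pose f : {rmorphism rat -> {poly C}} := (polyC \o ratr)%FUN.
have [s sE] := unipotent_sqrt f ZN; set V := horner_mx Z _ in sE.
exists V; split.
- move=> z z1; have : (\det (V *m V)).[z] != 0.
    rewrite sE one_addZ det_mulmx hornerM mulf_neq0 ?uW //.
    rewrite det_map_mx hornerC det_inv invr_eq0.
    by have := uW0; rewrite unitmxE unitfE.
  by rewrite det_mulmx hornerM; apply: contraNneq => ->; rewrite mul0r.
- move=> phi phiW; rewrite /V map_horner_mx -map_poly_comp; congr (horner_mx _ _).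
    rewrite map_mxB map_mxM phiW map_mx1; congr (_ *m _ - _).
    transitivity (map_mx polyC (map_mx phi (invmx W0))).
      by apply/matrixP => i j; rewrite !mxE /= map_polyC.
    rewrite map_invmx; congr (map_mx _ (invmx _)).
    apply/matrixP => i j; rewrite !mxE; case: ifP => _; last by rewrite rmorph0.
    by rewrite -coef_map -[in RHS]phiW mxE.
  by apply: eq_map_poly => x; rewrite /= map_polyC /= fmorph_rat.
move=> z z0; have evV x : ev x V = horner_mx (ev x Z) (map_poly ratr s).
  rewrite /V map_horner_mx -map_poly_comp; congr (horner_mx _ _).
  by apply: eq_map_poly => y; rewrite /= /horner_eval hornerC.
rewrite -mulmxA !evV -(horner_mx_intertwine _ (skew_ratio_selfadjoint z0)) -evV mulmxA.
rewrite -map_mxM sE map_mxD map_mx1 ev_one_addZ mulmxA mulmxKV //.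
Qed.

End SkewSquareRoot.

(** * Real factors *)

Local Notation cj := (map_mx (map_poly Num.conj)).

Section RealFactors.
Variables (C : numClosedFieldType) (d : nat) (kappa : 'I_d -> int).
Implicit Types (P Q : 'M[{poly C}]_d).

Lemma cjK P : cj (cj P) = P.
Proof.
by apply/matrixP => i j; rewrite !mxE; apply/polyP => k; rewrite !coef_map /= conjCK.
Qed.

Lemma ev_cj P (z : C) : ev z (cj P) = map_mx Num.conj (ev z^* P).
Proof.
apply/matrixP => i j; rewrite !mxE /horner_eval -{1}(conjCK z).
exact: horner_map.
Qed.

Lemma disk_unit_cj P : disk_unit P -> disk_unit (cj P).
Proof.
move=> uP z z1; rewrite -det_ev ev_cj det_map_mx fmorph_eq0 det_ev uP //.
by rewrite norm_conjC.
Qed.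

Lemma wh_cj P Q (z : C) : z != 0 ->
  wh (cj P) kappa (cj Q) z = map_mx Num.conj (wh P kappa Q z^*).
Proof.
move=> z0; rewrite /wh !map_mxM !ev_cj !map_trmx -fmorphV; congr (_ *m _ *m _).
apply/matrixP => i j; rewrite !mxE; case: eqP => _; rewrite ?mulr0n ?rmorph0 //.
by rewrite !mulr1n -fmorphXz /= conjCK.
Qed.

Lemma tr_wh (kappa1 : 'I_d -> int) P Q (z : C) :
  (wh P kappa1 Q z^-1)^T = wh Q (fun i => - kappa1 i) P z.
Proof.
rewrite /wh !trmx_mul trmxK invrK mulmxA tr_diag_mx; congr (_ *m _ *m _).
by congr diag_mx; apply/rowP => i; rewrite !mxE exprz_inv.
Qed.

(** [T] comes from rigidity of the transposed identity, where [Q] and [Q'] lead and the indices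
    change sign. *)
Lemma rigid_factors P P' Q Q' :
    disk_unit P -> disk_unit Q' ->
    (forall z : C, z != 0 -> wh P kappa Q z = wh P' kappa Q' z) ->
  exists U T : 'M[{poly C}]_d, P *m U = P' /\ Q' *m T = Q.
Proof.
move=> uP uQ' PQ; have [U PU] := rigid_factor uP uQ' PQ.
have [|T QT] := rigid_factor (Q := P') (Q' := P) (P := Q') (P' := Q)
   (kappa := fun i => - kappa i) (kappa' := fun i => - kappa i) uQ' uP.
  by move=> z z0; rewrite -!tr_wh PQ ?invr_eq0.
by exists U, T.
Qed.

Lemma wh_inj P Q Q' : disk_unit P -> disk_unit Q' ->
  (forall z : C, z != 0 -> wh P kappa Q z = wh P kappa Q' z) -> Q = Q'.
Proof.
move=> uP uQ' PQ; have [_ [T [_ QT]]] := rigid_factors uP uQ' PQ.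
rewrite -QT -[RHS]mulmx1; congr (_ *m _); apply/matrixP => j i.
apply: poly_eq_punctured => z z0; have zi0 : z^-1 != 0 by rewrite invr_eq0.
have := rigid_relation i j uP uQ' PQ (mulmx1 P) QT zi0; rewrite invrK !mxE eq_sym.
have [->|ij] := eqVneq j i; first by rewrite subrr expr0z mul1r => <-; rewrite !hornerC.
rewrite !mulr0n !horner0 => /esym/eqP.
by rewrite mulf_eq0 expfz_eq0 (negPf zi0) andbF => /eqP.
Qed.

(* For [a = x + i] with [x] real, [det (a + conj a *: U1)] is a polynomial in
   [x] whose value at the nonreal point [x = i] is [(2 i)^d]. *)
Lemma conj_combination_unit (U1 : 'M[C]_d) :
  exists2 a : C, a != 0 & \det (a%:M + a^* *: U1) != 0.
Proof.
pose q : {poly C} := \det ('X *: map_mx polyC (1%:M + U1)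
                           + map_mx polyC ('i *: (1%:M - U1))).
have qE x : q.[x] = \det ((x + 'i)%:M + (x - 'i) *: U1).
  rewrite -det_ev map_mxD; congr (\det _); apply/matrixP => i j.
  by rewrite !mxE /= /horner_eval /= !hornerE; ring.
have q0 : q != 0.
  suff : q.['i] != 0 by apply: contraNneq => ->; rewrite horner0.
  rewrite qE subrr scale0r addr0 det_scalar expf_neq0 // -mulr2n mulrn_eq0.
  by rewrite negb_or /= neq0Ci.
have [n qn] := poly_nat_nonroot q0.
have cE : (n.+1%:R + 'i)^* = n.+1%:R - 'i :> C.
  by rewrite rmorphD /= conjCi rmorph_nat.
exists (n.+1%:R + 'i); last by rewrite cE -qE.
apply/eqP => a0; have := congr1 (fun x => x + x^*) a0.
rewrite cE a0 conjC0 addr0 add0r => b0; have /eqP : (n.+1 + n.+1)%:R = 0 :> C.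
  by rewrite natrD; transitivity ((n.+1%:R + 'i) + (n.+1%:R - 'i) : C);
     [ring | rewrite a0 add0r b0].
by rewrite pnatr_eq0.
Qed.

(** Here [P U = cj P], so [P' = P (a + conj a U)] is real. The matching change [mix T] on the other
    side is moved through [D] by [rigid_relation]. *)
Lemma real_factors P Q : disk_unit P -> disk_unit Q ->
    (forall z : C, z != 0 -> wh (cj P) kappa (cj Q) z = wh P kappa Q z) ->
  exists P' Q' : 'M[{poly C}]_d,
    [/\ disk_unit P', disk_unit Q', cj P' = P', cj Q' = Q' &
        forall z : C, z != 0 -> wh P kappa Q z = wh P' kappa Q' z].
Proof.
move=> uP uQ PQr; have PQc z z0 := esym (PQr z z0).
have ucP := disk_unit_cj uP; have ucQ := disk_unit_cj uQ.
have [U [T [PU QT]]] := rigid_factors uP ucQ PQc.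
have [a a0 aU] := conj_combination_unit (ev 1 U).
pose mix (X : 'M[{poly C}]_d) := (a%:P)%:M + (a^*)%:P *: X.
have ev_mix z X : ev z (mix X) = a%:M + a^* *: ev z X.
  rewrite map_mxD map_scalar_mx map_mxZ; congr (_%:M + _ *: _); exact: hornerC.
have UT z : z != 0 ->
    ev z (mix U) *m Dk kappa z = Dk kappa z *m (ev z^-1 (mix T))^T.
  move=> z0; rewrite !ev_mix linearD linearZ /= tr_scalar_mx mulmxDl mulmxDr.
  rewrite scalar_mxC -scalemxAl -scalemxAr; congr (_ + _ *: _).
  apply/matrixP => i j; rewrite mul_diag_mx mul_mx_diag !mxE /horner_eval.
  rewrite (rigid_relation i j uP ucQ PQc PU QT) // mulrAC -expfzDr // subrK.
  by [].
have detUT z : z != 0 -> (\det (mix U)).[z] = (\det (mix T)).[z^-1].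
  move=> z0; have := congr1 determinant (UT z z0).
  rewrite !det_mulmx det_tr mulrC !det_ev => /mulfI; apply.
  by rewrite det_Dk // expfz_neq0.
(* By [detUT] this determinant is polynomial both in [z] and in [1/z], hence constant; the choice of
   [a] makes it nonzero at 1. *)
have [c c0 detU] : exists2 c, c != 0 & \det (mix U) = c%:P.
  have d1 : (\det (mix U)).[1] != 0 by rewrite -det_ev ev_mix.
  have d0 : \det (mix U) != 0 by apply: contraNneq d1 => ->; rewrite horner0.
  have s1 : (size (\det (mix U)) <= 1)%N.
    have := @size_laurent C _ (\det (mix T)) 0 _ d0; rewrite add0r lez_nat.
    by apply=> z z0; rewrite expr0z mul1r detUT.
  exists (\det (mix U))`_0; last exact: size1_polyC.
  by move: d1; rewrite (size1_polyC s1) hornerC coefC.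
have detT : \det (mix T) = c%:P.
  apply: poly_eq_punctured => z z0.
  by rewrite -[z in LHS]invrK -detUT ?invr_eq0 // detU !hornerC.
pose P' := P *m mix U; pose Q' := (c^-1)%:P *: (Q *m \adj (mix T)).
have Q'T : Q' *m mix T = Q.
  rewrite -scalemxAl -mulmxA mul_adj_mx detT mul_mx_scalar scalerA -polyCM mulVf //.
  by rewrite scale1r.
have uP' : disk_unit P'.
  by move=> z z1; rewrite det_mulmx detU hornerM hornerC mulf_neq0 ?uP.
have uQ' : disk_unit Q'.
  move=> z /uQ; rewrite -Q'T det_mulmx hornerM; apply: contraNneq => ->.
  by rewrite mul0r.
have P'E : P' = a%:P *: P + (a^*)%:P *: cj P.
  by rewrite /P' mulmxDr mul_mx_scalar -scalemxAr PU.
have rP' : cj P' = P'.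
  rewrite P'E map_mxD !map_mxZ cjK addrC; congr (_ + _).
    by rewrite /= map_polyC /= conjCK.
  by rewrite /= map_polyC.
have whE z : z != 0 -> wh P kappa Q z = wh P' kappa Q' z.
  move=> z0; rewrite /wh -Q'T map_mxM trmx_mul /P' map_mxM -!mulmxA.
  by congr (_ *m _); rewrite !mulmxA UT.
(* [Q'] is real because [cj Q'] and [Q'] complete the same [P'] to the same product. *)
exists P', Q'; split=> //; apply: (@wh_inj P') => // z z0.
by rewrite -{1}rP' -whE // -PQr // !wh_cj // whE // fmorph_eq0.
Qed.

End RealFactors.

(** * Laurent matrices and their polynomial parts *)

Lemma sum_symmetric_opp (V : nmodType) (b : nat) (G : int -> V) :
  \sum_(k < b.*2.+1) G (- (k%:Z - b%:Z)) = \sum_(k < b.*2.+1) G (k%:Z - b%:Z).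
Proof.
rewrite (reindex_inj rev_ord_inj) /=; apply: eq_bigr => k _; congr G.
by have := ltn_ord k; lia.
Qed.

Lemma sum_symmetric_nneg (V : nmodType) (b : nat) (G : int -> V) :
    (forall r : int, r < 0 -> G r = 0) ->
  \sum_(k < b.*2.+1) G (k%:Z - b%:Z) = \sum_(k < b.+1) G k%:Z.
Proof.
move=> G0; rewrite (_ : b.*2.+1 = b + b.+1)%N; last by lia.
rewrite big_split_ord /= big1 ?add0r => [|k _].
  by apply: eq_bigr => k _; congr G; lia.
by apply: G0; have := ltn_ord k; lia.
Qed.

Section LaurentMatrices.
Variables (R : realType) (d : nat).
Local Notation C := R[i].
Implicit Types (A : lmx R d) (X : 'M[{poly C}]_d) (z : C).

Definition poly_coef X (r : int) : 'M[C]_d :=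
  if r is Posz n then \matrix_(i, j) (X i j)`_n else 0.

Definition poly_bound X : nat := \max_i \max_j size (X i j).

Lemma size_poly_bound X i j : (size (X i j) <= poly_bound X)%N.
Proof.
apply: leq_trans (leq_bigmax (F := fun i => \max_j size (X i j)) i).
exact: (leq_bigmax (F := fun j => size (X i j)) j).
Qed.

Lemma poly_coefP X (r : int) : (poly_bound X < `|r|)%N -> poly_coef X r = 0.
Proof.
case: r => n //= bn; apply/matrixP => i j; rewrite !mxE nth_default //.
by rewrite (leq_trans (size_poly_bound X i j)) // ltnW.
Qed.

Definition lmx_of_poly X : lmx R d := LMx (@poly_coefP X).

Lemma is_poly_z_of_poly X : is_poly_z (lmx_of_poly X).
Proof. by case. Qed.

Lemma ev_sum_coef X z b : (poly_bound X <= b)%N ->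
  \sum_(k < b.+1) z ^+ k *: poly_coef X k = ev z X.
Proof.
move=> Xb; apply/matrixP => i j; rewrite summxE mxE /horner_eval.
rewrite (@horner_coef_wide _ b.+1); last first.
  by rewrite (leq_trans (size_poly_bound X i j)) // ltnW.
by apply: eq_bigr => k _; rewrite !mxE mulrC.
Qed.

Lemma lev_of_poly X z : lev (lmx_of_poly X) z = ev z X.
Proof.
rewrite /lev (sum_symmetric_nneg _ (G := fun r => z ^ r *: lcoef _ r)).
  exact: ev_sum_coef.
by case=> // n _; rewrite scaler0.
Qed.

Lemma levT_of_poly X z : levT (lmx_of_poly X) z = (ev z^-1 X)^T.
Proof.
rewrite -lev_of_poly linear_sum; apply: eq_bigr => k _.
by rewrite linearZ /= -exprz_inv.
Qed.

(** Negative powers are dropped, so this is faithful only under [is_poly_z]. *)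
Definition poly_of_lmx A : 'M[{poly C}]_d :=
  \matrix_(i, j) \poly_(k < (lbound A).+1) lcoef A k i j.

Lemma ev_poly_of_lmx A z : is_poly_z A -> ev z (poly_of_lmx A) = lev A z.
Proof.
move=> pA; rewrite /lev (sum_symmetric_nneg _ (G := fun r => z ^ r *: lcoef _ r)).
  apply/matrixP => i j; rewrite summxE !mxE /horner_eval horner_poly.
  by apply: eq_bigr => k _; rewrite mxE mulrC.
by move=> r r0; rewrite pA // scaler0.
Qed.

Fact lmx_tr_subproof A (r : int) :
  (lbound A < `|r|)%N -> (lcoef A (- r))^T = 0.
Proof. by move=> rb; rewrite lcoefP ?trmx0 // abszN. Qed.

(** The Laurent matrix [A^T]; it turns a factor polynomial in [1/z] into one polynomial in [z]. *)
Definition lmx_tr A : lmx R d := LMx (@lmx_tr_subproof A).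

Lemma lev_tr A z : lev (lmx_tr A) z = (lev_inv A z)^T.
Proof.
rewrite /lev_inv linear_sum.
transitivity (\sum_(k < (lbound A).*2.+1)
  (z ^ (k%:Z - (lbound A)%:Z)) *: (lcoef A (- (k%:Z - (lbound A)%:Z)))^T) => //.
rewrite -(sum_symmetric_opp _ (fun r => z ^ r *: (lcoef A (- r))^T)).
by apply: eq_bigr => k _; rewrite linearZ /= opprK.
Qed.

Lemma lev_inv_inv A z : lev_inv A z^-1 = lev A z.
Proof. by apply: eq_bigr => k _; rewrite exprz_inv opprK. Qed.

Lemma tr_lev_skew A z : (forall r : int, (lcoef A (- r))^T = - lcoef A r) ->
  (lev A z^-1)^T = - lev A z.
Proof.
move=> skA; rewrite -(lev_inv_inv A z^-1) invrK -lev_tr /lev -sumrN.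
by apply: eq_bigr => k _; rewrite /= skA scalerN.
Qed.

Lemma lev_real A z : z != 0 -> lmx_real A -> map_mx Num.conj (lev A z^*) = lev A z.
Proof.
move=> z0 rA; apply/matrixP => i j; rewrite mxE !summxE rmorph_sum.
apply: eq_bigr => k _; rewrite !mxE rmorphM; congr (_ * _).
  by rewrite fmorphXz /= conjCK.
exact/CrealP/rA.
Qed.

End LaurentMatrices.

(** * The matrix [D3] as an antidiagonal form *)

Section AntidiagonalForm.
Variables (R : realType) (d : nat) (kappa : 'I_d -> int).
Local Notation C := R[i].
Hypothesis even_d : ~~ odd d.
Hypothesis kappa_rev : forall i, kappa (rev_ord i) = - kappa i.

(** The sign of the entry of [D3] in column [i]. For index zero the two halves of the range break
    the tie, which makes the sign odd under [rev_ord]. *)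
Definition pair_sign (F : pzRingType) (i : 'I_d) : F :=
  if (kappa i < 0) || (kappa i == 0) && (i < d./2)%N then 1 else -1.

Lemma rev_ord_neq (i : 'I_d) : rev_ord i != i.
Proof.
apply: contra even_d => /eqP/(congr1 val) /= ri.
have -> : d = i.*2.+1 by have := ltn_ord i; lia.
by rewrite /= odd_double.
Qed.

Lemma half_rev_ord (i : 'I_d) : (rev_ord i < d./2)%N = ~~ (i < d./2)%N.
Proof. by have := ltn_ord i; have := even_halfK even_d; rewrite /=; lia. Qed.

Lemma pair_sign_rev (F : pzRingType) (i : 'I_d) :
  pair_sign F (rev_ord i) = - pair_sign F i.
Proof.
rewrite /pair_sign half_rev_ord kappa_rev oppr_lt0 oppr_eq0.
by case: ltgtP => //= _; case: (i < _)%N; rewrite ?opprK.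
Qed.

Lemma D3_entry (z : C) (i j : 'I_d) :
  D3 kappa z i j = if i == rev_ord j then z ^ kappa j * pair_sign C j else 0.
Proof.
(* [sum1] and [sum2] collapse a sum against the entry of a matrix unit to the one index that
   matches. *)
have sum1 (p : pred 'I_d) (f : 'I_d -> C) (k : 'I_d) (b : 'I_d -> bool) :
    \sum_(m | p m) f m * ((b m) && (k == m))%:R = if p k && b k then f k else 0.
  rewrite big_mkcond (bigD1 k) //= eqxx andbT big1 => [|m mk].
    by case: (p k); case: (b k); rewrite ?mulr1 ?mulr0 addr0.
  by rewrite eq_sym (negPf mk) andbF mulr0 if_same.
have sum2 (p : pred 'I_d) (f : 'I_d -> C) (k : 'I_d) (b : 'I_d -> bool) :
    \sum_(m | p m) f m * ((k == m) && (b m))%:R = if p k && b k then f k else 0.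
  by rewrite -sum1; apply: eq_bigr => m _; rewrite andbC.
rewrite /D3 mxE [X in X + _]mxE !summxE.
under eq_bigr do rewrite !mxE; rewrite sumrB sum1 sum2.
under eq_bigr do rewrite !mxE -[X in X - _]mul1r -[X in _ - X]mul1r.
rewrite sumrB (sum1 _ (fun=> 1)) (sum2 _ (fun=> 1)).
rewrite (_ : (j == rev_ord i) = (i == rev_ord j)); last first.
  by rewrite -(inj_eq rev_ord_inj) rev_ordK eq_sym.
case: eqP => [->|_]; last by rewrite !andbF !subrr oppr0 addr0.
rewrite !andbT kappa_rev opprK oppr_gt0 oppr_eq0.
rewrite -[((rev_ord j).+1 <= _)%N]/(rev_ord j < _)%N half_rev_ord /pair_sign.
case: ltgtP => k0 //=.
- by rewrite !subr0 addr0 mulrN1.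
- by rewrite sub0r opprK subrr addr0 mulr1.
- rewrite -k0 expr0z mul1r subrr oppr0 add0r.
  by case: (j < _)%N; rewrite /= ?subr0 ?sub0r.
Qed.

(** On the left the entry of row [i] carries [z ^ kappa i], whereas in [D3] that exponent belongs to
    column [i]; reversing the basis exchanges the two. *)
Lemma pairing_D3 (z : C) :
  pairing (@rev_ord d) (pair_sign C) *m Dk (fun i => - kappa i) z =
  (perm_mx (perm (@rev_ord_inj d)))^T *m D3 kappa z *m perm_mx (perm (@rev_ord_inj d)).
Proof.
set s := perm _; have sV : s^-1%g = s.
  by apply/permP => i; apply: (canLR (permK s)); rewrite !permE rev_ordK.
have JE (A : 'M[C]_d) i j :
    ((perm_mx s)^T *m A *m perm_mx s) i j = A (rev_ord i) (rev_ord j).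
  by rewrite tr_perm_mx -row_permE -{2}[s]invgK -col_permE sV !mxE !permE.
apply/matrixP => i j; rewrite JE D3_entry rev_ordK mul_mx_diag !mxE kappa_rev.
rewrite pair_sign_rev.
rewrite [rev_ord i == j]eq_sym; case: eqP => [->|_]; last by rewrite mul0r.
by rewrite pair_sign_rev opprK mulrC.
Qed.

End AntidiagonalForm.

(** * The factorization *)

(** In the real case Gram-Schmidt is run over [R] on the real parts of [B], and the resulting [S] is
    embedded back. *)
Lemma skew_normal_form_conj (R : realType) (d : nat) (Freal : bool)
    (kappa : 'I_d -> int) (B : 'M[R[i]]_d) :
    ~~ odd d -> (forall i, kappa (rev_ord i) = - kappa i) ->
    skew_kappa kappa B -> (Freal -> map_mx Num.conj B = B) ->
  exists S : 'M[R[i]]_d,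
    [/\ S \in unitmx, graded kappa kappa S, Freal -> map_mx Num.conj S = S &
        B = S *m pairing (@rev_ord d) (pair_sign kappa _) *m S^T].
Proof.
move=> ed kr sB; pose nf F := @skew_normal_form F d kappa (@rev_ord d)
  (pair_sign kappa F) (@rev_ordK d) (rev_ord_neq ed) kr.
have sign0 (F : numFieldType) i : pair_sign kappa F i != 0.
  by rewrite /pair_sign; case: ifP => _; rewrite ?oppr_eq0 oner_eq0.
case: Freal => [/(_ isT) rB|_]; last first.
  have [//|S [uS gS SE]] := nf _ (sign0 _) (pair_sign_rev ed kr _) B.
  by exists S.
pose re : 'M[R]_d := map_mx (@complex.Re R) B.
have BE : map_mx (real_complex R) re = B.
  apply/matrixP => i j; rewrite !mxE; apply: RRe_real; apply/CrealP.
  by rewrite -[in RHS]rB mxE.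
have [|S [uS gS SE]] := nf R (sign0 _) (pair_sign_rev ed kr _) re.
  have [sk uB gB] := sB; split.
  - apply: (@map_mx_inj _ _ (real_complex R)).
    by rewrite -map_trmx map_mxN BE.
  - by rewrite -(map_unitmx (real_complex R)) BE.
  - by move=> i j rij; apply: gB; rewrite -BE mxE fmorph_eq0.
exists (map_mx (real_complex R) S); split.
- by rewrite map_unitmx.
- by move=> i j; rewrite mxE fmorph_eq0 => /gS.
- by move=> _; apply/matrixP => i j; rewrite !mxE; apply: conjc_real.
rewrite -BE SE !map_mxM map_trmx; congr (_ *m _ *m _).
apply/matrixP => i j; rewrite !mxE; case: ifP => _; last by rewrite rmorph0.
by rewrite /pair_sign; case: ifP => _; rewrite ?rmorphN rmorph1.
Qed.

Lemma disk_unit_mul (C : numClosedFieldType) (d : nat) (X Y : 'M[{poly C}]_d) :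
  disk_unit X -> disk_unit Y -> disk_unit (X *m Y).
Proof. by move=> uX uY z z1; rewrite det_mulmx hornerM mulf_neq0 ?uX ?uY. Qed.

Lemma ev_const (C : comNzRingType) (m n : nat) (S : 'M[C]_(m, n)) (z : C) :
  ev z (map_mx polyC S) = S.
Proof. by rewrite -map_mx_comp map_mx_id // => x; apply: hornerC. Qed.

Lemma disk_unit_const (C : numClosedFieldType) (d : nat) (S : 'M[C]_d) :
  S \in unitmx -> disk_unit (map_mx polyC S).
Proof. by move=> uS z _; rewrite -det_ev ev_const -unitfE -unitmxE. Qed.

(** The normal form [E] of the constant skew matrix enters as a hypothesis, so that the argument
    runs over any closed field and treats the real and complex cases together. *)
Lemma skew_factorization (C : numClosedFieldType) (n : nat) (Freal : bool)
    (kappa : 'I_n.+1 -> int) (P Q : 'M[{poly C}]_n.+1) (E : 'M[C]_n.+1) :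
    (~~ odd n.+1 -> (forall i, kappa (rev_ord i) = - kappa i) ->
      forall B, skew_kappa kappa B -> (Freal -> map_mx Num.conj B = B) ->
      exists S : 'M[C]_n.+1, [/\ S \in unitmx, graded kappa kappa S,
        Freal -> map_mx Num.conj S = S & B = S *m E *m S^T]) ->
    disk_unit P -> disk_unit Q -> (Freal -> cj P = P /\ cj Q = Q) ->
    (forall m m' : 'I_n.+1, (m <= m')%N -> kappa m' <= kappa m) ->
    (forall z, z != 0 -> (wh P kappa Q z^-1)^T = - wh P kappa Q z) ->
  [/\ ~~ odd n.+1, (forall i, kappa (rev_ord i) = - kappa i) &
  exists X : 'M[{poly C}]_n.+1,
    [/\ disk_unit X, Freal -> cj X = X &
        forall z, z != 0 -> wh P kappa Q z =
          ev z X *m (E *m Dk (fun i => - kappa i) z) *m (ev z^-1 X)^T]].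
Proof.
move=> nf uP uQ rPQ kmono skew.
have PQ z : z != 0 ->
    wh P kappa Q z = wh (- Q) (fun i => - kappa i) P z.
  move=> z0; rewrite -[LHS]opprK -skew // tr_wh /wh.
  by rewrite map_mxN !mulNmx.
have [W PW] := rigid_factor uP uP PQ.
have PNW : P *m (- W) = Q by rewrite mulmxN PW opprK.
have skewW i j z : z != 0 -> (W i j).[z] = z ^ (kappa i + kappa j) * (- W j i).[z^-1].
  move=> z0; rewrite (rigid_relation i j uP uP PQ PW PNW z0) opprK.
  by rewrite [(- W) j i]mxE.
have uW : disk_unit W.
  move=> z /uQ; rewrite -PNW mulmxN -mulNmx det_mulmx hornerM.
  by apply: contraNneq => ->; rewrite mulr0.
have rW : Freal -> cj W = W.
  move=> /rPQ[rP rQ]; apply: (scalemx_polyI (disk_unit_neq0 uP)).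
  rewrite -!mul_scalar_mx -mul_adj_mx -!mulmxA PW -rP -map_mxM PW map_mxN rQ.
  by rewrite rP.
have ed : ~~ odd n.+1 := skew_graded_even uW skewW.
have [s ks] := skew_kappa_perm uW skewW.
have kr := sorted_kappa_rev kmono ks.
have [V [uV rV VE]] := skew_square_root uW skewW.
have [|Fr|S [uS gS rS SE]] := nf ed kr (skew_lead kappa W).
- split; first exact: tr_skew_lead.
    exact: skew_lead_unit.
  exact: graded_skew_lead.
- apply/matrixP => i j; rewrite !mxE; case: ifP => _; last by rewrite rmorph0.
  by rewrite -coef_map -[in RHS](rW Fr) mxE.
split=> //; exists (P *m V *m map_mx polyC S); split.
- apply: disk_unit_mul; first exact: disk_unit_mul.
  exact: disk_unit_const.
- move=> Fr; rewrite !map_mxM (rV _ (rW Fr)); have [-> _] := rPQ Fr.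
  congr (_ *m _ *m _); rewrite -[in RHS](rS Fr).
  by apply/matrixP => i j; rewrite !mxE /= map_polyC.
move=> z z0; rewrite !map_mxM !ev_const !trmx_mul.
(* The product [P D Q^T] is rewritten as the congruence [P (W D^-1) P^T], from [Q = - P W] and the
   symmetry of [W]. *)
transitivity (ev z P *m (ev z W *m Dk (fun i => - kappa i) z) *m (ev z^-1 P)^T).
  rewrite /wh -PNW map_mxM trmx_mul !mulmxA; congr (_ *m _).
  rewrite -!mulmxA; congr (_ *m _).
  rewrite (ev_skew_graded skewW z0) mulNmx -!mulmxA Dk_mul // mulmx1.
  by rewrite map_mxN linearN mulmxN.
(* [S] preserves the grading, so its transpose commutes with [D^-1] and joins the right-hand
   factor. *)
have SD : S^T *m Dk (fun i => - kappa i) z = Dk (fun i => - kappa i) z *m S^T.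
  by apply/esym/graded_Dk => i j; rewrite mxE => /gS ->.
by rewrite (VE z z0) SE -[S *m E *m _ *m _]mulmxA SD !mulmxA.
Qed.

Lemma skew_factorization_D3 (R : realType) (n : nat) (Freal : bool)
    (kappa : 'I_n.+1 -> int) (P Q : 'M[{poly R[i]}]_n.+1) :
    disk_unit P -> disk_unit Q -> (Freal -> cj P = P /\ cj Q = Q) ->
    (forall m m' : 'I_n.+1, (m <= m')%N -> kappa m' <= kappa m) ->
    (forall z, z != 0 -> (wh P kappa Q z^-1)^T = - wh P kappa Q z) ->
  exists X : 'M[{poly R[i]}]_n.+1,
    [/\ disk_unit X, Freal -> cj X = X &
        forall z, z != 0 -> wh P kappa Q z = ev z X *m D3 kappa z *m (ev z^-1 X)^T].
Proof.
move=> uP uQ rPQ kmono skew.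
have nf (ed : ~~ odd n.+1) kr B :=
  @skew_normal_form_conj R n.+1 Freal kappa B ed kr.
have [ed kr [Y [uY rY YE]]] := skew_factorization nf uP uQ rPQ kmono skew.
pose J : 'M[R[i]]_n.+1 := perm_mx (perm (@rev_ord_inj n.+1)).
exists (Y *m map_mx polyC J^T); split.
- apply: (disk_unit_mul uY); apply: disk_unit_const.
  by rewrite unitmx_tr unitmx_perm.
- move=> /rY cY; rewrite map_mxM cY; congr (_ *m _).
  by apply/matrixP => i j; rewrite !mxE /= map_polyC /= rmorph_nat.
move=> z z0; rewrite (YE z z0) (pairing_D3 ed kr) -/J.
by rewrite !map_mxM !ev_const trmx_mul trmxK !mulmxA.
Qed.

Unset Implicit Arguments.
Set Strict Implicit.

(* Freal = true : F = R (real coefficients); Freal = false : F = C. *)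
Theorem theorem3p3 (R : realType) (d : nat) (Freal : bool) (A : lmx R d)
  (kappa : 'I_d -> int) :
  (Freal -> lmx_real A) ->
  (forall r : int, (lcoef A (- r))^T = - lcoef A r) ->
  (forall z : R[i], `|z| = 1 -> lev A z \in unitmx) ->
  WH_partial_indices A kappa ->
  exists Ap : lmx R d,
    [/\ Freal -> lmx_real Ap,
        is_poly_z Ap,
        (forall z : R[i], `|z| <= 1 -> lev Ap z \in unitmx) &
        (forall z : R[i], z != 0 ->
           lev A z = lev Ap z *m D3 kappa z *m levT Ap z)].
Proof.
move=> rA skA _ [kmono [Ap [Am [pAp uAp pAm uAm AE]]]].
pose P0 := poly_of_lmx Ap; pose Q0 := poly_of_lmx (lmx_tr Am).
have pQ : is_poly_z (lmx_tr Am).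
  by move=> r r0; rewrite /= pAm ?trmx0 // oppr_gt0.
have AE0 z : z != 0 -> lev A z = wh P0 kappa Q0 z.
  move=> z0; rewrite AE // /wh !ev_poly_of_lmx // lev_tr trmxK lev_inv_inv.
  by [].
have uP0 : disk_unit P0.
  by move=> z z1; rewrite -det_ev ev_poly_of_lmx // -unitfE -unitmxE uAp.
have uQ0 : disk_unit Q0.
  move=> z z1; rewrite -det_ev ev_poly_of_lmx // lev_tr det_tr -unitfE -unitmxE.
  exact: uAm.
have [P [Q [uP uQ rPQ {}AE]]] : exists P Q : 'M[{poly R[i]}]_d,
    [/\ disk_unit P, disk_unit Q, Freal -> cj P = P /\ cj Q = Q &
        forall z : R[i], z != 0 -> lev A z = wh P kappa Q z].
  case: (Freal) rA => [/(_ isT) rA|_]; last by exists P0, Q0.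
  have [|P [Q [uP uQ rP rQ E]]] := @real_factors _ _ kappa P0 Q0 uP0 uQ0.
    by move=> z z0; rewrite wh_cj // -!AE0 ?fmorph_eq0 // lev_real.
  by exists P, Q; split=> // z z0; rewrite AE0 // E.
have [X [uX rX XE]] : exists X : 'M[{poly R[i]}]_d,
    [/\ disk_unit X, Freal -> cj X = X &
        forall z, z != 0 -> wh P kappa Q z = ev z X *m D3 kappa z *m (ev z^-1 X)^T].
  (* Polynomials in a matrix require positive size; in size zero all matrices are equal. *)
  case: d => [|n] in A kappa rA skA kmono Ap Am pAp uAp pAm uAm P0 Q0 pQ AE0 uP0
    uQ0 P Q uP uQ rPQ AE *.
    by exists P; split=> // [/rPQ[]//|z _]; rewrite [LHS]flatmx0 [RHS]flatmx0.
  apply: skew_factorization_D3 => // z z0.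
  by rewrite -!AE ?invr_eq0 // tr_lev_skew.
exists (lmx_of_poly X); split.
- move=> /rX E [k|k] i j /=; last by rewrite mxE rpred0.
  by rewrite mxE; apply/CrealP; rewrite -coef_map -[in RHS]E mxE.
- exact: is_poly_z_of_poly.
- by move=> z z1; rewrite lev_of_poly unitmxE unitfE det_ev uX.
by move=> z z0; rewrite AE // XE // lev_of_poly levT_of_poly.
Qed.
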